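(* If $G$ is a singleton-partition graph of order $n$ with $\delta(G)=2$ that contains at least one full vertex, then $L_{\rm SCC}(G)=1$.
   Context: All graphs are finite and simple. A full vertex is a vertex adjacent to all other vertices. A set $D\subseteq V$ is dominating if every vertex not in $D$ has a neighbor in $D$. Two disjoint sets $A,B\subseteq V$ form a coalition if neither is dominating but $A\cup B$ is. A coalition partition of $G$ is a partition $\mathcal{P}$ of $V$ such that every member is either a dominating set of cardinality 1, or is not dominating and forms a coalition with some other member. The coalition graph ${\rm CG}(G,\mathcal{P})$ has vertex set $\mathcal{P}$, two members adjacent iff they form a coalition. $\Gamma_1$ is the partition of $V$ into singletons; $G$ is a singleton-partition graph (SP-graph) if $\Gamma_1$ is a coalition partition of $G$. A singleton coalition graph chain with initial graph $G_1$ is a sequence $G_1\to G_2\to\cdots$ where each graph having a successor is an SP-graph and its successor is ${\rm CG}(G_i,\Gamma_1)$ (up to isomorphism). The $G$-SC chain is such a chain starting at $G$ of maximum possible length (it continues as long as the current graph is an SP-graph). Its length $L_{\rm SCC}(G)$ is $k-1$ for a chain $G_1\to\cdots\to G_k$ and $\infty$ for an infinite chain, with the convention that if all graphs in the chain are isomorphic the length is $0$. *)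

(* Defs.v *)
From mathcomp Require Import all_boot.
From mathcomp Require Import boolp.

Set Implicit Arguments.
Unset Strict Implicit.
Unset Printing Implicit Defensive.

Record sgraph := SGraph {
  vertex :> finType;
  adj : rel vertex;
  adj_sym : symmetric adj;
  adj_irr : irreflexive adj }.

Section Graph.
Variable G : sgraph.
Implicit Types (v : G) (A B D : {set G}) (P : {set {set G}}).

Definition degree v : nat := #|[set u | adj v u]|.

(* The default value #|G| exceeds every degree, so it is irrelevant as soon
   as G is nonempty. *)
Definition min_degree : nat := \big[minn/#|G|]_(v : G) degree v.

Definition full_vertex v : bool := [forall u, (u != v) ==> adj v u].

Definition dominating D : bool :=
  [forall v, (v \notin D) ==> [exists u in D, adj v u]].

Definition coalition A B : bool :=
  [&& [disjoint A & B], ~~ dominating A, ~~ dominating B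
    & dominating (A :|: B)].

Definition coalition_partition P : bool :=
  partition P [set: G] &&
  [forall A in P,
     (dominating A && (#|A| == 1))
     || (~~ dominating A && [exists B in P, (B != A) && coalition A B])].

Definition singleton_partition : {set {set G}} := [set [set v] | v : G].

Definition sp_graph : bool := coalition_partition singleton_partition.

Lemma coalition_sym : symmetric coalition.
Proof.
move=> A B; rewrite /coalition disjoint_sym setUC.
by case: (dominating A); case: (dominating B); rewrite ?andbF.
Qed.

Lemma coalition_irr : irreflexive coalition.
Proof.
by move=> A; rewrite /coalition setUid; case: (dominating A); rewrite !andbF.
Qed.

Definition CG P : sgraph :=
  let T := {A : {set G} | A \in P} in
  @SGraph T (fun A B : T => coalition (val A) (val B))
    (fun A B : T => coalition_sym (val A) (val B))
    (fun A : T => coalition_irr (val A)).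

End Graph.

Arguments singleton_partition : clear implicits.

Definition graph_iso (G H : sgraph) : Prop :=
  exists f : G -> H, bijective f /\ forall x y, adj (f x) (f y) = adj x y.

Definition sc_succ (G H : sgraph) : Prop :=
  sp_graph G /\ graph_iso H (CG (singleton_partition G)).

(* Lengths live in option nat, with None standing for infinity.  A chain of
   length L is given by c 0 -> c 1 -> ... -> c L (by all of c if L is infinite);
   for finite L, the values of c beyond L are junk. *)
Definition index_le (i : nat) (L : option nat) : bool :=
  if L is Some k then i <= k else true.

Definition length_le (L1 L2 : option nat) : bool :=
  if L1 is Some k then index_le k L2 else ~~ isSome L2.

Definition sc_chain (c : nat -> sgraph) (L : option nat) : Prop :=
  forall i, index_le i.+1 L -> sc_succ (c i) (c i.+1).

Definition max_sc_chain (G : sgraph) (c : nat -> sgraph) (L : option nat) :=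
  [/\ c 0 = G, sc_chain c L &
      forall c' L', c' 0 = G -> sc_chain c' L' -> length_le L' L].

Definition all_isomorphic (c : nat -> sgraph) (L : option nat) : Prop :=
  forall i j, index_le i L -> index_le j L -> graph_iso (c i) (c j).

Definition is_scc_length (G : sgraph) (l : option nat) : Prop :=
  exists c L, max_sc_chain G c L /\
    l = if `[< all_isomorphic c L >] then Some 0 else L.

Lemma graph_iso_refl G : graph_iso G G.
Proof. by exists id; split=> //; exists id. Qed.

Lemma graph_iso_sym G H : graph_iso G H -> graph_iso H G.
Proof.
move=> [f [[g fK gK] adjf]]; exists g; split; first by exists f.
by move=> x y; rewrite -adjf !gK.
Qed.

Lemma graph_iso_trans G H K :
  graph_iso G H -> graph_iso H K -> graph_iso G K.
Proof.
move=> [f [bf af]] [g [bg ag]]; exists (g \o f); split; first exact: bij_comp.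
by move=> x y /=; rewrite ag af.
Qed.

Lemma mem_singleton_partition (G : sgraph) (v : G) :
  [set v] \in singleton_partition G.
Proof. exact: imset_f. Qed.

Section IsoInvariance.
Variables (G H : sgraph) (f : G -> H) (g : H -> G).
Hypotheses (fK : cancel f g) (gK : cancel g f).
Hypothesis adjf : forall x y, adj (f x) (f y) = adj x y.

Let finj : injective f := can_inj fK.

Lemma dominating_iso (A : {set G}) : dominating (f @: A) = dominating A.
Proof.
apply/forallP/forallP => dA v; apply/implyP => vA.
- have := dA (f v); rewrite mem_imset // vA => /exists_inP[_ /imsetP[u uA ->]].
  by rewrite adjf => vu; apply/exists_inP; exists u.
- have := dA (g v); rewrite -(mem_imset _ _ finj) gK vA => /exists_inP[u uA].
  rewrite -adjf gK => vu; apply/exists_inP; exists (f u) => //.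
  exact: imset_f.
Qed.

Lemma coalition_iso (A B : {set G}) :
  coalition (f @: A) (f @: B) = coalition A B.
Proof.
rewrite /coalition -imsetU !dominating_iso; congr (_ && _).
by rewrite imset_disjoint //; apply: in2W.
Qed.

End IsoInvariance.

Lemma sp_graphP (G : sgraph) :
  reflect (forall v : G, dominating [set v] \/
             exists u : G, coalition [set v] [set u])
          (sp_graph G).
Proof.
have dj (u v : G) : coalition [set v] [set u] -> [set u] != [set v].
  by apply: contraTN => /eqP ->; rewrite coalition_irr.
have part : partition (singleton_partition G) [set: G].
  apply/and3P; split.
  - rewrite eqEsubset subsetT; apply/subsetP => v _; apply/bigcupP.
    by exists [set v]; rewrite ?set11 ?mem_singleton_partition.
  - apply/trivIsetP => _ _ /imsetP[u _ ->] /imsetP[v _ ->] uv.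
    by rewrite disjoints1 in_set1; apply: contraNN uv => /eqP ->.
  - by apply/imsetP => -[v _ /setP/(_ v)]; rewrite !inE eqxx.
rewrite /sp_graph /coalition_partition part /=.
apply: (iffP forall_inP) => h => [v|_ /imsetP[v _ ->]].
- have := h _ (mem_singleton_partition v); case/orP => /andP[dv]; first by left.
  by case/exists_inP => _ /imsetP[u _ ->] /andP[_ ?]; right; exists u.
- case: (h v) => [dv|[u cvu]]; first by rewrite dv cards1.
  apply/orP; right; have /and4P[_ -> _ _] := cvu.
  apply/exists_inP; exists [set u]; first exact: mem_singleton_partition.
  by rewrite dj.
Qed.

Lemma sp_graph_iso G H : graph_iso G H -> sp_graph G -> sp_graph H.
Proof.
move=> [f [[g fK gK] adjf]] /sp_graphP spG; apply/sp_graphP => v.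
rewrite -[v]gK -imset_set1; have [d|[u c]] := spG (g v).
  by left; rewrite (dominating_iso fK gK adjf).
right; exists (f u); rewrite -[[set f u]]imset_set1.
by rewrite (coalition_iso fK gK adjf).
Qed.

Lemma CG_singleton_iso G H : graph_iso G H ->
  graph_iso (CG (singleton_partition G)) (CG (singleton_partition H)).
Proof.
move=> [f [[g fK gK] adjf]].
have im (K K' : sgraph) (h : K -> K') (A : {set K}) :
    A \in singleton_partition K -> h @: A \in singleton_partition K'.
  by case/imsetP => v _ ->; rewrite imset_set1 mem_singleton_partition.
pose F (A : CG (singleton_partition G)) : CG (singleton_partition H) :=
  Sub (f @: val A) (im _ _ f _ (valP A)).
pose F' (A : CG (singleton_partition H)) : CG (singleton_partition G) :=
  Sub (g @: val A) (im _ _ g _ (valP A)).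
have imK (K K' : sgraph) (h : K -> K') h' : cancel h h' ->
    forall A : {set K}, h' @: (h @: A) = A.
  move=> hK A; rewrite -imset_comp -[RHS]imset_id; apply: eq_imset => x /=.
  exact: hK.
exists F; split.
  by exists F' => A; apply: val_inj => /=; rewrite imK.
by move=> A B; rewrite /= (coalition_iso fK gK adjf).
Qed.

Lemma sc_chain_iso G c L c' L' :
  c 0 = G -> sc_chain c L -> c' 0 = G -> sc_chain c' L' ->
  forall i, index_le i L -> index_le i L' -> graph_iso (c i) (c' i).
Proof.
move=> c0 cc c0' cc'; elim=> [|i IHi] iL iL'.
  by rewrite c0 c0'; exact: graph_iso_refl.
have lt M : index_le i.+1 M -> index_le i M by case: M => //= k /ltnW.
have [_ e] := cc i iL; have [_ e'] := cc' i iL'.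
apply: graph_iso_trans e _; apply: graph_iso_trans (graph_iso_sym e').
by apply: CG_singleton_iso; apply: IHi; apply: lt.
Qed.

Lemma is_scc_length_ex G : exists l, is_scc_length G l.
Proof.
pose c i := iter i (fun H => CG (singleton_partition H)) G.
have ccP L : (forall i, index_le i.+1 L -> sp_graph (c i)) -> sc_chain c L.
  by move=> sp i iL; split; [exact: sp | exact: graph_iso_refl].
suff [L mL] : exists L, max_sc_chain G c L by eexists; exists c, L; split.
have [ex|nex] := pselect (exists k, ~~ sp_graph (c k)); last first.
  exists None; split=> //; last by move=> c' [k|].
  by apply: ccP => i _; apply/negPn/negP => ni; apply: nex; exists i.
pose k := ex_minn ex; have [nk mink] : ~~ sp_graph (c k) /\
    forall i, i < k -> sp_graph (c i).
  rewrite /k; case: ex_minnP => m nm minm; split=> // i im.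
  by apply/negPn/negP => /minm; rewrite leqNgt im.
have cck : sc_chain c (Some k) by apply: ccP => i; apply: mink.
exists (Some k); split=> // c' L' c0' cc'.
have [//|nle] := boolP (length_le L' (Some k)).
have kL' : index_le k.+1 L' by case: (L') nle => //= m; rewrite -ltnNge.
have kL : index_le k L' by case: (L') kL' => //= m /ltnW.
have [spk _] := cc' k kL'.
have := sc_chain_iso (erefl : c 0 = G) cck c0' cc' (leqnn k : index_le k (Some k)) kL.
by move/graph_iso_sym/sp_graph_iso => /(_ spk); rewrite (negPf nk).
Qed.

(* The unique l with is_scc_length G l; see L_SCCP below. *)
Definition L_SCC (G : sgraph) : option nat := projT1 (cid (is_scc_length_ex G)).

Lemma is_scc_length_uniq G l l' :
  is_scc_length G l -> is_scc_length G l' -> l = l'.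
Proof.
move=> [c [L [[c0 cc mc] ->]]] [c' [L' [[c0' cc' mc'] ->]]].
have eL : L = L'.
  have := mc' _ _ c0 cc; have := mc _ _ c0' cc'.
  case: L L' {cc mc cc' mc'} => [k|] [k'|] //= h h'.
  by congr Some; apply/eqP; rewrite eqn_leq h h'.
subst L'; have E := sc_chain_iso c0 cc c0' cc'.
suff -> : `[< all_isomorphic c L >] = `[< all_isomorphic c' L >] by [].
apply: asbool_equiv_eq; split=> h i j iL jL.
- apply: graph_iso_trans (graph_iso_sym (E i iL iL)) _.
  by apply: graph_iso_trans (E j jL jL); apply: h.
- apply: graph_iso_trans (E i iL iL) _.
  by apply: graph_iso_trans (graph_iso_sym (E j jL jL)); apply: h.
Qed.

Lemma L_SCCP G l : L_SCC G = l <-> is_scc_length G l.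
Proof.
rewrite /L_SCC; case: cid => l' /= h; split=> [<-//|].
exact: is_scc_length_uniq.
Qed.

(* Main.v *)
(** A full vertex [f] is isolated in the coalition graph [H] of the singleton
    partition, and [H] has other vertices, so if [H] were an SP-graph then [f]
    would have a coalition partner [u] in [H], necessarily adjacent in [H] to
    every vertex except [f]: in [G], the pair [{u, w}] is dominating for every
    [w] other than [f] and [u], and no vertex other than [f] is full.  Let [x]
    be a vertex of degree 2 with neighbours [f] and [y].  Whether [u] is [x],
    [y] or neither, [y] turns out to be full, a contradiction.  Hence the chain
    stops at [H], and [H] is not isomorphic to the SP-graph [G]. *)
Require Import Defs.
From mathcomp Require Import all_boot.
From mathcomp Require Import boolp.

Set Implicit Arguments.
Unset Strict Implicit.
Unset Printing Implicit Defensive.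

Lemma bigminn_leq (I : eqType) (r : seq I) (F : I -> nat) k j :
  j \in r -> \big[minn/k]_(i <- r) F i <= F j.
Proof.
elim: r => // a r IHr; rewrite inE big_cons => /predU1P[->|/IHr].
  exact: geq_minl.
exact: leq_trans (geq_minr _ _).
Qed.

Section Graph.
Variable G : sgraph.
Implicit Types u v w x y f : G.

Lemma degree_lt_card v : degree v < #|G|.
Proof.
rewrite -cardsT; apply: proper_card; apply/properP; split; first exact: subsetT.
by exists v; rewrite // inE adj_irr.
Qed.

Lemma min_degree_leq v : min_degree G <= degree v.
Proof. exact: bigminn_leq (mem_index_enum v). Qed.

(** The minimum could only fail to be attained by equalling the default [#|G|], and the degree of
    [v] lies below that. *)
Lemma min_degree_attained v : exists x : G, degree x = min_degree G.
Proof.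
have [e|//] : min_degree G = #|G| \/ exists x : G, degree x = min_degree G.
  rewrite /min_degree; elim/big_rec: _ => [|x m _ IH]; first by left.
  by rewrite minnC /minn; case: ifP => // _; right; exists x.
have := leq_ltn_trans (min_degree_leq v) (degree_lt_card v).
by rewrite e ltnn.
Qed.

Lemma full_adj f v : full_vertex f -> v != f -> adj f v.
Proof. by move=> /forallP/(_ v)/implyP. Qed.

Lemma full_vertex_degree f v : full_vertex f -> degree v <= degree f.
Proof.
move=> full_f; have -> : degree f = #|[set~ f]|.
  apply: eq_card => u; rewrite !inE; have [->|/full_adj->//] := eqVneq u f.
  exact: adj_irr.
by rewrite cardsC1 -ltnS prednK ?degree_lt_card // (cardD1 f).
Qed.

Lemma dominating1 v : dominating [set v] = full_vertex v.
Proof.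
apply: eq_forallb => u; rewrite in_set1; case: (u != v) => //=.
apply/exists_inP/idP => [[w /set1P->]|vu]; first by rewrite adj_sym.
by exists v; rewrite ?set11 // adj_sym.
Qed.

Lemma dominating2P u w :
  reflect (forall v, v != u -> v != w -> adj v u || adj v w)
          (dominating ([set u] :|: [set w])).
Proof.
apply: (iffP forallP) => dom v.
  move=> vu vw; have := dom v; rewrite !inE negb_or vu vw.
  by case/exists_inP => z; rewrite !inE => /orP[]/eqP-> ->; rewrite ?orbT.
apply/implyP; rewrite !inE negb_or => /andP[vu vw].
have /orP[a|a] := dom v vu vw; apply/exists_inP; [exists u|exists w] => //.
  by rewrite !inE eqxx.
by rewrite !inE eqxx orbT.
Qed.

Lemma coalition1P u w : coalition [set u] [set w] ->
  [/\ ~~ full_vertex u, ~~ full_vertex w &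
      forall v, v != u -> v != w -> adj v u || adj v w].
Proof. by rewrite /coalition !dominating1 => /and4P[_ ? ? /dominating2P]. Qed.

(** A full vertex has maximum degree, so if [f] itself attains the minimum, all degrees agree and
    any neighbour of [f] serves. *)
Lemma exists_degree_min_neq f : full_vertex f -> 0 < min_degree G ->
  exists2 x, x != f & degree x = min_degree G.
Proof.
move=> full_f min_gt0; have [x dx] := min_degree_attained f.
have [xf|] := eqVneq x f; last by exists x.
have /card_gt0P[z] : 0 < #|[set u | adj f u]|.
  exact: leq_trans min_gt0 (min_degree_leq f).
rewrite inE => fz; exists z.
  by apply: contraTneq fz => ->; rewrite adj_irr.
apply/eqP; rewrite eqn_leq min_degree_leq -dx xf andbT.
exact: full_vertex_degree.
Qed.

Lemma degree2_neighbours x f : adj x f -> degree x = 2 ->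
  exists2 y, y != f & forall v, adj x v = (v == f) || (v == y).
Proof.
move=> xf /eqP; rewrite /degree (cardsD1 f) inE xf eqSS => /cards1P[y Ny].
have := set11 y; rewrite -Ny !inE => /andP[yf xy]; exists y => // v.
have [->//|vf] := eqVneq v f.
by have /setP/(_ v) := Ny; rewrite !inE vf.
Qed.

Lemma no_universal_coalition_partner f u :
  min_degree G = 2 -> full_vertex f ->
  ~ (forall w, w != f -> w != u -> coalition [set u] [set w]).
Proof.
move=> min2 full_f co.
have [x xf] : exists2 x, x != f & degree x = min_degree G.
  by apply: exists_degree_min_neq; rewrite ?min2.
rewrite min2 => dx.
have xf_adj : adj x f by rewrite adj_sym full_adj.
have [y yf Nx] := degree2_neighbours xf_adj dx.
have xy : adj x y by rewrite Nx eqxx orbT.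
have yx : y != x by apply: contraTneq xy => ->; rewrite adj_irr.
(* [y] is [u] or a coalition partner of [u], and no member of a coalition is full. *)
suff full_y : full_vertex y.
  have [uy|yu] := eqVneq y u.
    have xu : x != u by rewrite -uy eq_sym.
    by have [] := coalition1P (co x xf xu); rewrite -uy full_y.
  by have [_] := coalition1P (co y yf yu); rewrite full_y.
apply/forallP => v; apply/implyP => vy.
have [->|vf] := eqVneq v f; first by rewrite adj_sym full_adj.
have [->|vx] := eqVneq v x; first by rewrite adj_sym.
have vNx : adj v x = false by rewrite adj_sym Nx (negPf vf) (negPf vy).
(* If [u] is [x] or [y], the coalition of [x] and [y] dominates [v], which is not adjacent to [x]
   and hence is adjacent to [y]. *)
have [ux|xu] := eqVneq x u.
  have yu : y != u by rewrite -ux.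
  have [_ _ dom] := coalition1P (co y yf yu).
  by rewrite adj_sym; have := dom v; rewrite -ux vNx; apply.
have [uy|yu] := eqVneq y u.
  have [_ _ dom] := coalition1P (co x xf xu).
  by rewrite adj_sym uy; have := dom v; rewrite -uy vNx orbF; apply.
(* [u] is not adjacent to [x], so [{u, w}] dominates [x] only for [w] among
   [x] and [y]; hence [v = u] and [G] has no vertices but [f], [u], [x], [y]. *)
have only w : w != f -> w != u -> w != x -> w == y.
  move=> wf wu wx; have [_ _ dom] := coalition1P (co w wf wu).
  have := dom x xu; rewrite eq_sym => /(_ wx).
  rewrite !Nx (negPf wf) [u == y]eq_sym (negPf yu) orbF /= => /orP[/eqP uf|//].
  exfalso; have [] := coalition1P (co x xf xu).
  by rewrite uf full_f.
have vu : v = u by apply/eqP; apply: contraNT vy => vu; apply: only.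
have : 1 < #|[set w | adj v w]| by rewrite -min2 min_degree_leq.
rewrite (cardsD1 f) inE [adj v f]adj_sym full_adj // ltnS => /card_gt0P[w].
rewrite !inE => /andP[wf vw]; suff <- : w = y by rewrite adj_sym.
apply/eqP/only => //.
  by apply: contraTneq vw => ->; rewrite vu adj_irr.
by apply: contraTneq vw => ->; rewrite vNx.
Qed.

Definition CG1_vertex v : CG (singleton_partition G) :=
  Sub [set v] (mem_singleton_partition v).

Lemma CG1_vertex_surj (A : CG (singleton_partition G)) :
  exists v, A = CG1_vertex v.
Proof. by case: A => A AP; have /imsetP[v _ e] := AP; exists v; exact: val_inj. Qed.

Lemma CG1_vertex_inj : injective CG1_vertex.
Proof. by move=> u v /(congr1 val)/set1_inj. Qed.

Lemma adj_CG1 u v :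
  adj (CG1_vertex u) (CG1_vertex v) = coalition [set u] [set v].
Proof. by []. Qed.

Lemma CG1_not_sp : min_degree G = 2 -> (exists f, full_vertex f) ->
  ~~ sp_graph (CG (singleton_partition G)).
Proof.
move=> min2 [f full_f]; apply/negP => /sp_graphP/(_ (CG1_vertex f)).
have f_isolated v : adj (CG1_vertex v) (CG1_vertex f) = false.
  by apply/negP; rewrite adj_CG1 => /coalition1P[_]; rewrite full_f.
case=> [|[U]].
  (* Only [x != f] matters here: the isolated vertex [f] cannot dominate [x]. *)
  have [x xf _] : exists2 x, x != f & degree x = min_degree G.
    by apply: exists_degree_min_neq; rewrite ?min2.
  move=> /forallP/(_ (CG1_vertex x)); rewrite in_set1.
  rewrite (inj_eq CG1_vertex_inj) xf => /exists_inP[_ /set1P->].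
  by rewrite f_isolated.
have [u ->] := CG1_vertex_surj U => /and4P[_ _ _ /forallP dom].
apply: (no_universal_coalition_partner (u := u) min2 full_f) => w wf wu.
have := dom (CG1_vertex w); rewrite !inE !(inj_eq CG1_vertex_inj).
rewrite (negPf wf) (negPf wu) => /exists_inP[z].
rewrite !inE => /orP[]/eqP->; first by rewrite f_isolated.
by rewrite adj_CG1 coalition_sym.
Qed.

End Graph.

(** Being an SP-graph is invariant under isomorphism. This bars a second step in every chain from
    [G], and it keeps [G] and its successor from being isomorphic, so the length 0 convention does
    not apply. *)
Lemma L_SCC_eq1 (G : sgraph) : sp_graph G ->
  ~~ sp_graph (CG (singleton_partition G)) -> L_SCC G = Some 1.
Proof.
move=> spG nspH; apply/L_SCCP.
pose c i := if i is 0 then G else CG (singleton_partition G).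
exists c, (Some 1); split.
  split=> // [[|i]//= _|c' L' c0' cc'].
    by split; [exact: spG | exact: graph_iso_refl].
  have [//|nle] := boolP (length_le L' (Some 1)).
  have L'2 : index_le 2 L' by case: (L') nle => //= m; rewrite -ltnNge.
  have L'1 : index_le 1 L' by case: (L') L'2 => //= m /ltnW.
  have [_] := cc' 0 L'1; rewrite c0' => iso1.
  have [sp1 _] := cc' 1 L'2.
  by have := sp_graph_iso iso1 sp1; rewrite (negPf nspH).
case: ifP => // /asboolP/(_ 0 1 isT isT)/sp_graph_iso/(_ spG).
by rewrite /= (negPf nspH).
Qed.

Theorem theorem11 (n : nat) (G : sgraph) (hn : #|G| = n) (hSP : sp_graph G)
  (hdelta : min_degree G = 2) (hfull : exists v : G, full_vertex v) :
  L_SCC G = Some 1.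
Proof. exact: L_SCC_eq1 hSP (CG1_not_sp hdelta hfull). Qed.
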